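(* Let $G$ be a topological group and let $N$ be a closed normal subgroup of $G$. If $N$ (with the subspace topology) and $G/N$ (with the quotient topology) are both TA, then $G$ is TA.
   Context: All topological groups are assumed to be Hausdorff. A topological group is topologically Archimedean (TA) if it has no proper open subgroups. *)

(* Defs.v *)
From HB Require Import structures.
From mathcomp Require Import all_boot all_classical.
From mathcomp Require Import topology.

Set Implicit Arguments.
Unset Strict Implicit.
Unset Printing Implicit Defensive.

Local Open Scope classical_set_scope.
Local Open Scope group_scope.
Local Open Scope quotient_scope.

HB.structure Definition PreTopologicalGroup :=
  {G of Topological G & Group G}.

HB.mixin Record isTopologicalGroup G & PreTopologicalGroup G := {
  mulg_continuous : continuous (fun x : G * G => x.1 * x.2) ;
  invg_continuous : continuous (fun x : G => x^-1) ;
  group_hausdorff : hausdorff_space G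
}.

(* Topological groups are Hausdorff, by convention. *)
#[short(type="topologicalGroupType")]
HB.structure Definition TopologicalGroup :=
  {G of PreTopologicalGroup G & isTopologicalGroup G}.

Definition subgroup (G : groupType) (H : set G) : Prop :=
  group_closed [in H].

Definition normal (G : groupType) (H : set G) : Prop :=
  forall x y : G, H x -> H (x ^ y).

Definition topologically_archimedean (G : topologicalGroupType) : Prop :=
  ~ exists H : set G, [/\ subgroup H, open H & H <> [set: G]].

Section SubgroupTheory.
Variables (G : groupType) (H : set G).
Hypothesis sH : subgroup H.

Lemma subgroup1 : H 1.
Proof. by have [/set_mem] := sH. Qed.

Lemma subgroupM x y : H x -> H y -> H (x * y).
Proof.
move=> Hx Hy; apply/set_mem/(group_closedM sH); exact: mem_set.
Qed.

Lemma subgroupV x : H x -> H x^-1.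
Proof. by move=> Hx; apply/set_mem/(group_closedV sH)/mem_set. Qed.

End SubgroupTheory.

(* The type [set_type N] already carries the subspace topology; the alias     *)
(* depends on the proof [sN] so that it can also carry the group structure.   *)
Definition subgroup_type (G : topologicalGroupType) (N : set G)
  (sN : subgroup N) : Type := set_type N.

Section SubgroupTopology.
Variables (G : topologicalGroupType) (N : set G) (sN : subgroup N).
Local Notation S := (subgroup_type sN).

HB.instance Definition _ := SubChoice.on S.
HB.instance Definition _ := Topological.copy S (set_type N).
HB.instance Definition _ := SubChoice_isSubGroup.Build G _ S sN.

Definition subgroup_val : S -> G := \val.
Local Notation v := subgroup_val.

Lemma subgroup_valM (x y : S) : v (x * y) = v x * v y.
Proof. exact: valM. Qed.

Lemma subgroup_valV (x : S) : v x^-1 = (v x)^-1.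
Proof.
have v1 : v 1 = 1 by exact: val1.
by rewrite -[LHS]mulg1 -(mulgV (v x)) mulgA -subgroup_valM mulVg v1 mul1g.
Qed.

Lemma subgroup_val_inj : injective v.
Proof. exact: val_inj. Qed.

Lemma subgroup_val_continuous : continuous v.
Proof. exact: (@initial_continuous (set_type N) G set_val). Qed.

Lemma subgroup_nbhsP (x : S) (A : set S) :
  nbhs x A <-> exists2 B, nbhs (v x) B & v @^-1` B `<=` A.
Proof.
split=> [[_ [/= [B oB <-] Bx BA]]|[B Bx BA]].
  by exists B => //; apply: open_nbhs_nbhs; split.
by apply: filterS BA _; exact: subgroup_val_continuous.
Qed.

Let mulS_continuous : continuous (fun x : S * S => x.1 * x.2).
Proof.
move=> [x y] A /subgroup_nbhsP[B]; rewrite subgroup_valM => Bxy BA.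
have [[C D] /= [Cx Dy] CDB] := @mulg_continuous G (v x, v y) _ Bxy.
exists (v @^-1` C, v @^-1` D) => /=.
  by split; exact: subgroup_val_continuous.
move=> [u w] [/= Cu Dw]; apply: BA; rewrite /preimage /= subgroup_valM.
exact: (CDB (v u, v w)).
Qed.

Let invS_continuous : continuous (fun x : S => x^-1).
Proof.
move=> x A /subgroup_nbhsP[B]; rewrite subgroup_valV => Bx BA.
apply/subgroup_nbhsP; exists ((fun z : G => z^-1) @^-1` B).
  exact: invg_continuous.
by move=> u /= Bu; apply: BA; rewrite /preimage /= subgroup_valV.
Qed.

Let hausdorffS : hausdorff_space S.
Proof.
move=> x y clxy; apply/subgroup_val_inj/group_hausdorff => A B Ax By.
have [z [Az Bz]] :=
  clxy _ _ (subgroup_val_continuous Ax) (subgroup_val_continuous By).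
by exists (v z).
Qed.

HB.instance Definition _ := isTopologicalGroup.Build S
  mulS_continuous invS_continuous hausdorffS.

End SubgroupTopology.

Section Coset.
Variables (G : groupType) (N : set G) (sN : subgroup N).

Definition coset_rel : rel G := [rel x y | x^-1 * y \in N].

Lemma coset_relP x y : reflect (N (x^-1 * y)) (coset_rel x y).
Proof. by apply: (iffP idP) => [/set_mem|/mem_set]. Qed.

Lemma coset_rel_refl : reflexive coset_rel.
Proof. by move=> x; apply/coset_relP; rewrite mulVg; exact: subgroup1. Qed.

Lemma coset_rel_sym : symmetric coset_rel.
Proof.
suff h x y : coset_rel x y -> coset_rel y x by move=> x y; apply/idP/idP => /h.
move=> /coset_relP/(subgroupV sN) Nyx; apply/coset_relP.
by move: Nyx; rewrite invgM invgK.
Qed.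

Lemma coset_rel_trans : transitive coset_rel.
Proof.
move=> y x z /coset_relP Nxy /coset_relP Nyz; apply/coset_relP.
by have := subgroupM sN Nxy Nyz; rewrite mulgA mulgK.
Qed.

Definition coset_equiv : equiv_rel G :=
  EquivRel coset_rel coset_rel_refl coset_rel_sym coset_rel_trans.

End Coset.

(* Closedness of [N] is only used to make the quotient Hausdorff. *)
Definition quotient_group (G : topologicalGroupType) (N : set G)
    (sN : subgroup N) (nN : normal N) (cN : closed N) : Type :=
  quotient_topology {eq_quot (coset_equiv sN)}.

Section QuotientGroup.
Variables (G : topologicalGroupType) (N : set G).
Variables (sN : subgroup N) (nN : normal N) (cN : closed N).
Local Notation Q := (quotient_group sN nN cN).

HB.instance Definition _ :=
  Topological.copy Q (quotient_topology {eq_quot (coset_equiv sN)}).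
HB.instance Definition _ :=
  Quotient.copy Q (quotient_topology {eq_quot (coset_equiv sN)}).

Lemma eq_cosetP (x y : G) : \pi_Q x = \pi_Q y <-> N (x^-1 * y).
Proof.
split=> [xy|Nxy].
  by apply/coset_relP; exact: (introT (@eqmodP _ (coset_equiv sN) x y) xy).
apply: (elimT (@eqmodP _ (coset_equiv sN) x y)); exact/coset_relP.
Qed.

Definition quotient_one : Q := \pi_Q 1.
Definition quotient_mul (a b : Q) : Q := \pi_Q (repr a * repr b).
Definition quotient_inv (a : Q) : Q := \pi_Q (repr a)^-1.

Let pi_surj (a : Q) : exists x, a = \pi_Q x.
Proof. by exists (repr a); rewrite reprK. Qed.

Let repr_pi (x : G) : N (x^-1 * repr (\pi_Q x)).
Proof. by apply/eq_cosetP; rewrite reprK. Qed.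

Lemma pi_quotient_mul (x y : G) :
  quotient_mul (\pi_Q x) (\pi_Q y) = \pi_Q (x * y).
Proof.
apply/esym/eq_cosetP.
set x' := repr _; set y' := repr _.
have Nx : N (x^-1 * x') by exact: repr_pi.
have Ny : N (y^-1 * y') by exact: repr_pi.
have := subgroupM sN (nN y Nx) Ny.
by rewrite /conjg invgM -!mulgA mulVKg.
Qed.

Lemma pi_quotient_inv (x : G) : quotient_inv (\pi_Q x) = \pi_Q x^-1.
Proof.
apply/eq_cosetP; set x' := repr _.
have /(nN x^-1) : N (x^-1 * x') by exact: repr_pi.
by rewrite /conjg !invgK mulgA mulVKg.
Qed.

Let quotient_mulA : associative quotient_mul.
Proof.
move=> a b c; have [x ->] := pi_surj a.
have [y ->] := pi_surj b; have [z ->] := pi_surj c.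
by rewrite !pi_quotient_mul mulgA.
Qed.

Let quotient_mul1g : left_id quotient_one quotient_mul.
Proof.
by move=> a; have [x ->] := pi_surj a; rewrite pi_quotient_mul mul1g.
Qed.

Let quotient_mulg1 : right_id quotient_one quotient_mul.
Proof.
by move=> a; have [x ->] := pi_surj a; rewrite pi_quotient_mul mulg1.
Qed.

Let quotient_mulVg : left_inverse quotient_one quotient_inv quotient_mul.
Proof.
move=> a; have [x ->] := pi_surj a.
by rewrite pi_quotient_inv pi_quotient_mul mulVg.
Qed.

Let quotient_mulgV : right_inverse quotient_one quotient_inv quotient_mul.
Proof.
move=> a; have [x ->] := pi_surj a.
by rewrite pi_quotient_inv pi_quotient_mul mulgV.
Qed.

HB.instance Definition _ := isGroup.Build Q quotient_mulA quotient_mul1g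
  quotient_mulg1 quotient_mulVg quotient_mulgV.

Lemma piM (x y : G) : \pi_Q (x * y) = \pi_Q x * \pi_Q y.
Proof. by rewrite -pi_quotient_mul. Qed.

Lemma piV (x : G) : \pi_Q x^-1 = (\pi_Q x)^-1.
Proof. by rewrite -pi_quotient_inv. Qed.

Let piQ_continuous : continuous (\pi_Q : G -> Q).
Proof. exact: (@pi_continuous G {eq_quot (coset_equiv sN)}). Qed.

Let mulr_continuous (n : G) : continuous (fun x : G => x * n).
Proof.
move=> x; apply: (@continuous_comp _ _ _ (fun x => (x, n))
  (fun z : G * G => z.1 * z.2)); last exact: mulg_continuous.
by apply: cvg_pair; [exact: cvg_id|exact: cvg_cst].
Qed.

Lemma pi_open (U : set G) : open U -> open (\pi_Q @` U : set Q).
Proof.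
move=> oU; rewrite /open /= /quotient_open.
rewrite (_ : _ @^-1` _ = \bigcup_(n in N) ((fun x => x * n) @^-1` U)).
  apply: bigcup_open => n _.
  by apply: open_comp => // x _; exact: mulr_continuous.
apply/seteqP; split=> x /= [y].
  move=> Uy /esym/eq_cosetP Nxy; exists (x^-1 * y) => //=.
  by rewrite mulVKg.
move=> Ny Uxy; exists (x * y) => //; apply/esym/eq_cosetP.
by rewrite mulKg.
Qed.

Let pi_nbhs (x : G) (A : set G) : nbhs x A -> nbhs (\pi_Q x) (\pi_Q @` A).
Proof.
rewrite nbhsE => -[U [oU Ux] UA].
apply: (@filterS _ _ _ (\pi_Q @` U)); first exact: image_subset.
apply: open_nbhs_nbhs.
by split; [exact: pi_open|exists x].
Qed.

Let mulQ_continuous : continuous (fun z : Q * Q => z.1 * z.2).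
Proof.
move=> [a b]; have [x ->] := pi_surj a; have [y ->] := pi_surj b => A /=.
rewrite -piM => /piQ_continuous Axy.
have [[C D] /= [Cx Dy] CDA] := @mulg_continuous G (x, y) _ Axy.
exists (\pi_Q @` C, \pi_Q @` D) => /=; first by split; exact: pi_nbhs.
move=> [_ _] [/= [u Cu <-] [v Dv <-]]; rewrite /= -piM.
exact: (CDA (u, v)).
Qed.

Let invQ_continuous : continuous (fun a : Q => a^-1).
Proof.
move=> a; have [x ->] := pi_surj a => A /=.
rewrite -piV => /piQ_continuous /invg_continuous/pi_nbhs.
by apply: filterS => _ [u /= Au <-]; rewrite /= -piV.
Qed.

Let hausdorffQ : hausdorff_space Q.
Proof.
move=> a b; have [x ->] := pi_surj a; have [y ->] := pi_surj b => clxy.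
apply/eq_cosetP; apply: contrapT => NxyN.
have divl_continuous : continuous (fun z : G * G => z.1^-1 * z.2).
  move=> z; apply: (@continuous_comp _ _ _ (fun z : G * G => (z.1^-1, z.2))
    (fun z : G * G => z.1 * z.2)); last exact: mulg_continuous.
  apply: cvg_pair; last exact: cvg_snd.
  by apply: continuous_comp; [exact: cvg_fst|exact: invg_continuous].
have nNxy : nbhs (x^-1 * y) (~` N).
  by apply: open_nbhs_nbhs; split => //; exact: closed_openC.
have [[C D] /= [Cx Dy] CDN] := divl_continuous (x, y) _ nNxy.
have [_ [[u Cu <-] [v Dv /esym/eq_cosetP uv]]] :=
  clxy _ _ (pi_nbhs Cx) (pi_nbhs Dy).
exact: (CDN (u, v)).
Qed.

HB.instance Definition _ := isTopologicalGroup.Build Q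
  mulQ_continuous invQ_continuous hausdorffQ.

End QuotientGroup.

(* Main.v *)
Require Import Defs.
From mathcomp Require Import all_boot all_classical topology.

(** An open subgroup [H] of [G] is seen by both pieces of the extension.  Its
    trace on [N] is an open subgroup of [N], hence all of [N], so [N] lies in
    [H].  Its image in [G/N] is a subgroup, open because the quotient map is
    open, hence all of [G/N], so every coset of [N] meets [H].  A subgroup
    that contains [N] and meets every coset of [N] is the whole group. *)

Set Implicit Arguments.
Unset Strict Implicit.

Local Open Scope classical_set_scope.
Local Open Scope group_scope.

(** [group_closed] asks for closure under division; the traces and images
    below are handled more directly through the product and the inverse. *)
Lemma subgroup_intro (G : groupType) (H : set G) :
  H 1 -> (forall x y, H x -> H y -> H (x * y)) -> (forall x, H x -> H x^-1) ->
  subgroup H.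
Proof.
move=> H1 HM HV; split; first exact: mem_set.
by move=> x y /set_mem Hx /set_mem Hy; apply/mem_set/HM => //; exact: HV.
Qed.

Lemma topologically_archimedean_open_subgroup (G : topologicalGroupType)
    (H : set G) :
  topologically_archimedean G -> subgroup H -> open H -> H = [set: G].
Proof.
by move=> taG sH oH; apply: contrapT => HneT; apply: taG; exists H.
Qed.

Section Trace.
Variables (G : topologicalGroupType) (N H : set G) (sN : subgroup N).
Hypothesis sH : subgroup H.
Local Notation v := (@subgroup_val G N sN).

Lemma subgroup_preimage_val : subgroup (v @^-1` H).
Proof.
have v1 : v 1 = 1 by exact: val1.
apply: subgroup_intro => [|x y|x]; rewrite /preimage /=.
- by rewrite v1; exact: subgroup1.
- by rewrite subgroup_valM; exact: subgroupM.
- by rewrite subgroup_valV; exact: subgroupV.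
Qed.

(** The inclusion of [N] is continuous, so the trace of [H] is an open subgroup
    of [N] and cannot be proper. *)
Lemma topologically_archimedean_sub :
  topologically_archimedean (subgroup_type sN) -> open H -> N `<=` H.
Proof.
move=> taN oH n Nn.
have oHN : open (v @^-1` H).
  by apply: open_comp => // x _; exact: subgroup_val_continuous.
have vHT := topologically_archimedean_open_subgroup taN
  subgroup_preimage_val oHN.
have : (v @^-1` H) (SigSub (mem_set Nn)) by rewrite vHT.
by [].
Qed.

End Trace.

Section Image.
Variables (G : topologicalGroupType) (N H : set G).
Variables (sN : subgroup N) (nN : normal N) (cN : closed N).
Hypothesis sH : subgroup H.
Local Notation Q := (quotient_group sN nN cN).
Local Notation pi := (\pi_Q%qT : G -> Q).

Lemma subgroup_image_pi : subgroup (pi @` H).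
Proof.
apply: subgroup_intro => [|_ _ [x Hx <-] [y Hy <-]|_ [x Hx <-]].
- by exists 1 => //; exact: subgroup1.
- by exists (x * y); [exact: subgroupM|exact: piM].
- by exists x^-1; [exact: subgroupV|exact: piV].
Qed.

(** The quotient map is open, so the image of [H] is an open subgroup of [G/N]
    and cannot be proper: the coset of [g] is then the coset of some element
    of [H]. *)
Lemma topologically_archimedean_meets_cosets :
  topologically_archimedean Q -> open H ->
  forall g, exists2 h, H h & N (h^-1 * g).
Proof.
move=> taQ oH g.
have piHT := topologically_archimedean_open_subgroup taQ
  subgroup_image_pi (pi_open _ _ _ oH).
have [h Hh hg] : (pi @` H) (pi g) by rewrite piHT.
by exists h => //; apply/(@eq_cosetP G N sN nN cN).
Qed.

End Image.

Theorem proposition2p6 (G : topologicalGroupType) (N : set G)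
    (sN : subgroup N) (nN : normal N) (cN : closed N) :
  topologically_archimedean (subgroup_type sN) ->
  topologically_archimedean (quotient_group sN nN cN) ->
  topologically_archimedean G.
Proof.
move=> taN taQ [H [sH oH]]; apply; apply/seteqP; split=> // g _.
have NH := topologically_archimedean_sub sH taN oH.
have [h Hh Nhg] := topologically_archimedean_meets_cosets sH taQ oH g.
by rewrite -(mulVKg h g); apply: subgroupM => //; exact: NH.
Qed.
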